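(* Let $1\le p\le n$, let $f:\mathbb{C}^{n\times n}\to\mathbb{R}$ be smooth, $F(Y)=f(YY^* )$ on $\mathbb{C}^{n\times p}$, and $h(\pi(Y))=F(Y)$ on $\mathbb{C}^{n\times p}_*/\mathcal{O}_p$. Then Riemannian gradient descent for $h$ on $\mathbb{C}^{n\times p}_*/\mathcal{O}_p$ with the metric induced by $g^1$ and the retraction $R_{\pi(Y)}(\tau\eta_{\pi(Y)})=\pi(Y+\tau\overline\eta_Y)$, that is, the iteration $Y_{k+1}=Y_k-\tau_k\,\overline{\operatorname{grad}h(\pi(Y_k))}_{Y_k}$, is equivalent to the Burer--Monteiro gradient descent method $Y_{k+1}=Y_k-\tau_k\nabla F(Y_k)$ with suitable step sizes (namely, the same $\tau_k$), in the sense that, started from the same $Y_0\in\mathbb{C}^{n\times p}_*$, they produce exactly the same iterates (as long as the iterates have full rank $p$, so that the retraction is defined).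
   Context: Complex matrix spaces are real vector spaces with inner product $\langle A,B\rangle=\Re(\mathrm{tr}(A^*B))$, and $\nabla F$ is the gradient of $F$ on $\mathbb{C}^{n\times p}$ with respect to it. $\mathbb{C}^{n\times p}_*$ is the set of rank-$p$ matrices in $\mathbb{C}^{n\times p}$, $\mathcal{O}_p$ is the group of $p\times p$ unitary matrices acting by $Y\mapsto YO$, and $\pi$ is the projection to the quotient. $g^1_Y(A,B)=\Re(\mathrm{tr}(A^*B))$ on $\mathbb{C}^{n\times p}_*$. The vertical space at $Y$ is $\{Y\Omega:\Omega^*=-\Omega\}$, the horizontal space $\mathcal{H}^1_Y$ is its $g^1$-orthogonal complement, and $\overline\xi_Y\in\mathcal{H}^1_Y$ denotes the horizontal lift at $Y$ of a tangent vector $\xi_{\pi(Y)}$ of the quotient, i.e. $\mathrm{D}\pi(Y)[\overline\xi_Y]=\xi_{\pi(Y)}$. The quotient metric is $g^1_{\pi(Y)}(\xi,\zeta)=g^1_Y(\overline\xi_Y,\overline\zeta_Y)$, and $\operatorname{grad}h$ is the Riemannian gradient with respect to it. *)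

(* Defs.v *)
From HB Require Import structures.
From mathcomp Require Import all_boot all_order all_algebra.
From mathcomp Require Import sesquilinear spectral generic_quotient complex.
From mathcomp Require Import all_classical all_reals.
From mathcomp Require Import topology normedtype derive.

Set Implicit Arguments.
Unset Strict Implicit.
Unset Printing Implicit Defensive.

Import Order.TTheory GRing.Theory Num.Theory.
Import numFieldNormedType.Exports.

Local Open Scope classical_set_scope.
Local Open Scope ring_scope.
Local Open Scope complex_scope.
Local Open Scope sesquilinear_scope.
Local Open Scope quotient_scope.

Section RealCalculus.
Context {R : realType}.

(* [F] is C^infinity on the open set [U] iff its iterated directional          *)
(* derivatives of all orders exist and are Frechet differentiable on [U].      *)
Fixpoint smooth_upto (V : normedModType R) (k : nat) (U : set V) (F : V -> R)
    : Prop :=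
  (forall x, U x -> differentiable F x) /\
  (if k is k'.+1 then forall v, smooth_upto k' U (fun x => 'D_v F x) else True).

Definition smooth_on (V : normedModType R) (U : set V) (F : V -> R) : Prop :=
  forall k, smooth_upto k U F.

(* Complex matrices carry no normed structure over [R] in the library, so real *)
(* calculus on them goes through the linear identification X + iY <-> (X, Y).  *)
Definition to_real (m q : nat) (A : 'M[R[i]]_(m, q))
    : 'M[R]_(m, q) * 'M[R]_(m, q) :=
  (map_mx (@complex.Re R) A, map_mx (@complex.Im R) A).

Definition of_real (m q : nat) (Z : 'M[R]_(m, q) * 'M[R]_(m, q))
    : 'M[R[i]]_(m, q) :=
  \matrix_(i < m, j < q) (Z.1 i j +i* Z.2 i j).

Definition smooth_mx (m q : nat) (U : set 'M[R[i]]_(m, q))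
    (F : 'M[R[i]]_(m, q) -> R) : Prop :=
  smooth_on (@of_real m q @^-1` U) (F \o @of_real m q).

Definition differentiable_mx (m q : nat) (F : 'M[R[i]]_(m, q) -> R)
    (Y : 'M[R[i]]_(m, q)) : Prop :=
  differentiable (F \o @of_real m q) (to_real Y).

Definition diff_mx (m q : nat) (F : 'M[R[i]]_(m, q) -> R)
    (Y A : 'M[R[i]]_(m, q)) : R :=
  'D_(to_real A) (F \o @of_real m q) (to_real Y).

Definition inner (m q : nat) (A B : 'M[R[i]]_(m, q)) : R :=
  complex.Re (\tr (A^t* *m B)).

Definition is_nabla (m q : nat) (F : 'M[R[i]]_(m, q) -> R)
    (Y G : 'M[R[i]]_(m, q)) : Prop :=
  differentiable_mx F Y /\ forall A, diff_mx F Y A = inner G A.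

Definition nabla (m q : nat) (F : 'M[R[i]]_(m, q) -> R) (Y : 'M[R[i]]_(m, q))
    : 'M[R[i]]_(m, q) :=
  xget 0 [set G | is_nabla F Y G].

End RealCalculus.

Section Quotient.
Context {R : realType} {n p : nat}.

Record fullrank : Type :=
  FullRank { fr_mx :> 'M[R[i]]_(n, p); _ : \rank fr_mx == p }.
HB.instance Definition _ := [isSub for fr_mx].
HB.instance Definition _ := [Choice of fullrank by <:].

Definition unitary_equiv (Y Z : fullrank) : bool :=
  `[< exists2 O : 'M[R[i]]_p, O \is unitarymx & (Z : 'M_(n, p)) = Y *m O >].

Lemma unitary_equiv_refl : reflexive unitary_equiv.
Proof.
move=> Y; apply/asboolP; exists 1%:M; last by rewrite mulmx1.
by apply/unitarymxP; rewrite trmx1 map_mx1 mulmx1.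
Qed.

Lemma unitary_equiv_sym : symmetric unitary_equiv.
Proof.
suff H Y Z : unitary_equiv Y Z -> unitary_equiv Z Y.
  by move=> Y Z; apply/idP/idP; exact: H.
move=> /asboolP[O Ou ZE]; apply/asboolP; exists (O^t* ).
  by rewrite trmxC_unitary.
by rewrite ZE mulmxtVK.
Qed.

Lemma unitary_equiv_trans : transitive unitary_equiv.
Proof.
move=> Y X Z /asboolP[O Ou YE] /asboolP[O' Ou' ZE]; apply/asboolP.
by exists (O *m O'); rewrite ?mul_unitarymx// ZE YE mulmxA.
Qed.

Canonical unitary_equiv_equiv := EquivRel unitary_equiv
  unitary_equiv_refl unitary_equiv_sym unitary_equiv_trans.

Definition uquot := {eq_quot unitary_equiv}.
HB.instance Definition _ := EqQuotient.on uquot.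
HB.instance Definition _ := Choice.on uquot.

Definition quot_proj (Y : fullrank) : uquot := \pi_uquot Y.

(* The value off the open set of full rank matrices is irrelevant. *)
Definition pullback (phi : uquot -> R) (Y : 'M[R[i]]_(n, p)) : R :=
  if insub Y is Some Z then phi (quot_proj Z) else 0.

(* The quotient manifold structure is the one that makes [quot_proj] a smooth  *)
(* submersion: a function on the quotient is smooth iff its pullback is.       *)
Definition smooth_quot (phi : uquot -> R) : Prop :=
  smooth_mx [set Y | \rank Y = p] (pullback phi).

(* Tangent vectors of the quotient are derivations acting on smooth functions. *)
(* They are extended by 0 to the other functions, so that equality of tangent  *)
(* vectors is equality on smooth functions.                                    *)
Definition tangent_vector := (uquot -> R) -> R.

Definition dproj (Y : fullrank) (A : 'M[R[i]]_(n, p)) : tangent_vector :=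
  fun phi => if `[< smooth_quot phi >] then diff_mx (pullback phi) Y A else 0.

(* [quot_proj] is a submersion: its differential is onto the tangent space.    *)
Definition tangent (x : uquot) (xi : tangent_vector) : Prop :=
  exists Y A, quot_proj Y = x /\ xi = dproj Y A.

Definition g1 (Y : fullrank) (A B : 'M[R[i]]_(n, p)) : R := inner A B.

Definition vertical (Y : fullrank) (B : 'M[R[i]]_(n, p)) : Prop :=
  exists2 Omega : 'M[R[i]]_p, Omega^t* = - Omega & B = Y *m Omega.

Definition horizontal (Y : fullrank) (A : 'M[R[i]]_(n, p)) : Prop :=
  forall B, vertical Y B -> g1 Y A B = 0.

(* [xget] defaults to 0; for tangent vectors at [quot_proj Y] there is exactly  *)
(* one such lift.                                                              *)
Definition hlift (Y : fullrank) (xi : tangent_vector) : 'M[R[i]]_(n, p) :=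
  xget 0 [set A | horizontal Y A /\ dproj Y A = xi].

(* By unitary invariance of [g1] the choice of representative is immaterial.   *)
Definition qmetric (x : uquot) (xi zeta : tangent_vector) : R :=
  g1 (repr x) (hlift (repr x) xi) (hlift (repr x) zeta).

(* [zeta h] is the derivative of [h] along [zeta], which requires [h] smooth.  *)
Definition is_rgrad (h : uquot -> R) (x : uquot) (xi : tangent_vector) : Prop :=
  [/\ smooth_quot h, tangent x xi
    & forall zeta, tangent x zeta -> qmetric x xi zeta = zeta h].

Definition rgrad (h : uquot -> R) (x : uquot) : tangent_vector :=
  xget (fun=> 0) [set xi | is_rgrad h x xi].

(* [retraction x t eta] is R_x(t eta); it is undefined when Y + t eta_Y is not *)
(* of full rank. It does not depend on the representative Y of [x].            *)
Definition retraction (x : uquot) (t : R) (eta : tangent_vector)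
    : option uquot :=
  omap quot_proj (insub ((repr x : 'M_(n, p)) + t%:C *: hlift (repr x) eta)).

Fixpoint rgd_quot (h : uquot -> R) (tau : nat -> R) (x0 : uquot) (k : nat)
    : option uquot :=
  if k is k'.+1 then
    obind (fun x => retraction x (- tau k') (rgrad h x))
      (rgd_quot h tau x0 k')
  else Some x0.

Fixpoint rgd (h : uquot -> R) (tau : nat -> R) (Y0 : fullrank) (k : nat)
    : option fullrank :=
  if k is k'.+1 then
    obind (fun Y : fullrank =>
        insub ((Y : 'M_(n, p)) - (tau k')%:C *: hlift Y (rgrad h (quot_proj Y))))
      (rgd h tau Y0 k')
  else Some Y0.

Fixpoint burer_monteiro (F : 'M[R[i]]_(n, p) -> R) (tau : nat -> R)
    (Y0 : 'M[R[i]]_(n, p)) (k : nat) : 'M[R[i]]_(n, p) :=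
  if k is k'.+1 then
    let Y := burer_monteiro F tau Y0 k' in Y - (tau k')%:C *: nabla F Y
  else Y0.

End Quotient.

Arguments fullrank R n p : clear implicits.
Arguments uquot R n p : clear implicits.

(* Main.v *)
From HB Require Import structures.
Require Import Defs.
From mathcomp Require Import all_boot all_order all_algebra.
From mathcomp Require Import sesquilinear spectral generic_quotient complex.
From mathcomp Require Import all_classical all_reals.
From mathcomp Require Import topology normedtype landau derive.

(* Everything reduces to: the horizontal lift at Y of grad h is nabla F(Y).   *)
(* Since F is invariant under right multiplication by unitary matrices, its   *)
(* derivative vanishes on vertical vectors Y W, so nabla F(Y) is horizontal;  *)
(* it represents DF(Y), hence, restricted to horizontal vectors, Dh. To turn  *)
(* this into a statement about horizontal lifts one needs that every tangent  *)
(* vector has a lift: a Sylvester equation yields the vertical part of a      *)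
(* matrix, and the Cayley transform shows that functions on the quotient do   *)
(* not see vertical directions. One also needs that the lift is unique: the   *)
(* functions Re tr(M^* Y Y^* ) on the quotient determine A Y^* + Y A^*, which *)
(* is zero only for vertical A.                                               *)

Import Order.TTheory GRing.Theory Num.Theory.
Import numFieldNormedType.Exports.

Local Open Scope classical_set_scope.
Local Open Scope ring_scope.
Local Open Scope complex_scope.
Local Open Scope sesquilinear_scope.

Set Implicit Arguments.
Unset Strict Implicit.

(** * The real inner product of complex matrices *)

(** The metric $g^1$ is the ambient inner product, so all turns on whether the Euclidean gradient is
    already a horizontal lift. $F$ is constant on unitary orbits, so $\nabla F(Y)$ is orthogonal to
    the vertical space ([nabla_horizontal]) and represents the derivative of [h] on horizontal
    vectors; this is [rgradE], and [hlift_rgrad] after lifting. A lifted Riemannian step is thus a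
    Burer-Monteiro step ([rgd_burer_monteiro]). Since $\nabla F(YQ)=\nabla F(Y)Q$ for unitary $Q$
    ([nabla_unitary]), the step taken from any other representative stays in the same class
    ([retraction_rgrad], [rgd_quotE]).

    The work lies in recovering lifts from tangent vectors, which are known only through their
    action on smooth functions. Existence ([tangent_lift]) combines [horizontal_projection] with
    [diff_vertical]; uniqueness ([horizontal_lift_unique]) needs enough smooth functions on the
    quotient, and the [gram_form] family supplies them. The closure lemmas on smoothness serve to
    show that $F$ and these forms are smooth and that full rank is an open condition. *)

Section Inner.
Context {R : realType}.
Implicit Types (m q r : nat).

Lemma trmxCM m q r (A : 'M[R[i]]_(m, q)) (B : 'M_(q, r)) :
  (A *m B)^t* = B^t* *m A^t*.
Proof. by rewrite trmx_mul map_mxM. Qed.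

Lemma trmxCD m q (A B : 'M[R[i]]_(m, q)) : (A + B)^t* = A^t* + B^t*.
Proof. by rewrite linearD map_mxD. Qed.

Lemma trmxCN m q (A : 'M[R[i]]_(m, q)) : (- A)^t* = - A^t*.
Proof. by rewrite linearN map_mxN. Qed.

Lemma trmxC_realZ m q (t : R) (A : 'M[R[i]]_(m, q)) :
  (t%:C *: A)^t* = t%:C *: A^t*.
Proof.
rewrite linearZ map_mxZ; congr (_ *: _).
by apply/eqP; rewrite eq_complex /= oppr0 !eqxx.
Qed.

Lemma innerE m q (A B : 'M[R[i]]_(m, q)) :
  inner A B = \sum_i \sum_j (complex.Re (A i j) * complex.Re (B i j)
                            + complex.Im (A i j) * complex.Im (B i j)).
Proof.
rewrite /inner /mxtrace (raddf_sum (@complex.Re R : Rcomplex R -> R)).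
rewrite exchange_big /=.
apply: eq_bigr => j _; rewrite !mxE.
rewrite (raddf_sum (@complex.Re R : Rcomplex R -> R)).
apply: eq_bigr => i _; rewrite !mxE.
by case: (A i j) (B i j) => a b [c d] /=; rewrite mulNr opprK.
Qed.

Lemma innerC m q (A B : 'M[R[i]]_(m, q)) : inner A B = inner B A.
Proof.
rewrite !innerE; apply: eq_bigr => i _; apply: eq_bigr => j _.
by rewrite mulrC; congr (_ + _); rewrite mulrC.
Qed.

Lemma innerDr m q (A B C : 'M[R[i]]_(m, q)) :
  inner A (B + C) = inner A B + inner A C.
Proof.
by rewrite /inner mulmxDr raddfD (raddfD (@complex.Re R : Rcomplex R -> R)).
Qed.

Lemma innerNr m q (A B : 'M[R[i]]_(m, q)) : inner A (- B) = - inner A B.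
Proof.
by rewrite /inner mulmxN raddfN (raddfN (@complex.Re R : Rcomplex R -> R)).
Qed.

Lemma innerZr m q (A : 'M[R[i]]_(m, q)) (t : R) B :
  inner A (t%:C *: B) = t * inner A B.
Proof.
rewrite /inner -scalemxAr linearZ /=.
by case: (\tr _) => a b /=; rewrite mul0r subr0.
Qed.

Lemma innerBl m q (A B C : 'M[R[i]]_(m, q)) :
  inner (A - B) C = inner A C - inner B C.
Proof. by rewrite innerC innerDr innerNr ![inner C _]innerC. Qed.

Lemma inner_trmxC m q (A B : 'M[R[i]]_(m, q)) :
  inner (A^t* ) (B^t* ) = inner A B.
Proof.
rewrite !innerE exchange_big; apply: eq_bigr => i _; apply: eq_bigr => j _.
by rewrite !mxE; case: (A i j) (B i j) => a b [c d] /=; rewrite mulrNN.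
Qed.

Lemma inner_mulr m q r (A : 'M[R[i]]_(m, r)) (B : 'M_(m, q)) (C : 'M_(q, r)) :
  inner A (B *m C) = inner (B^t* *m A) C.
Proof. by rewrite /inner trmxCM trmxCK mulmxA. Qed.

Lemma inner_mull m q r (A : 'M[R[i]]_(m, r)) (B : 'M_(m, q)) (C : 'M_(q, r)) :
  inner A (B *m C) = inner (A *m C^t* ) B.
Proof. by rewrite /inner trmxCM trmxCK mulmxA mxtrace_mulC mulmxA. Qed.

Lemma inner_ge0 m q (A : 'M[R[i]]_(m, q)) : 0 <= inner A A.
Proof.
rewrite innerE sumr_ge0 // => i _; apply: sumr_ge0 => j _.
by rewrite -!expr2 addr_ge0 ?sqr_ge0.
Qed.

Lemma inner_eq0 m q (A : 'M[R[i]]_(m, q)) : inner A A = 0 -> A = 0.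
Proof.
rewrite innerE => /eqP; rewrite psumr_eq0 => [/allP Ai0|i _]; last first.
  by apply: sumr_ge0 => j _; rewrite -!expr2 addr_ge0 ?sqr_ge0.
apply/matrixP => i j; rewrite mxE.
have /eqP/eqP := Ai0 i (mem_index_enum _).
rewrite psumr_eq0 => [/allP/(_ j (mem_index_enum _))|k _]; last first.
  by rewrite -!expr2 addr_ge0 ?sqr_ge0.
rewrite -!expr2 paddr_eq0 ?sqr_ge0 // !sqrf_eq0.
by case: (A i j) => a b /= /andP[/eqP -> /eqP ->].
Qed.

Lemma inner_unitary m q (O : 'M[R[i]]_q) (A B : 'M_(m, q)) :
  O \is unitarymx -> inner (A *m O) (B *m O) = inner A B.
Proof. by move=> Ou; rewrite inner_mull mulmxtVK. Qed.

(** Taking adjoints preserves the inner product, so this pairing equals its own negative. *)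
Lemma inner_herm_skew q (X W : 'M[R[i]]_q) :
  X^t* = X -> W^t* = - W -> inner X W = 0.
Proof.
move=> Xh Ws; have := inner_trmxC X W; rewrite Xh Ws innerNr => /eqP.
by rewrite eqNr => /eqP.
Qed.

Lemma inner_nondeg m q (A B : 'M[R[i]]_(m, q)) :
  (forall C, inner A C = inner B C) -> A = B.
Proof.
move=> AB; apply/eqP; rewrite -subr_eq0; apply/eqP/inner_eq0.
by rewrite innerBl AB subrr.
Qed.

(** A left kernel matrix $K$ satisfies $K=tKW$, so $\langle K,K\rangle=t\langle K^*K,W\rangle$,
    which vanishes because $K^*K$ is Hermitian and $W$ skew. *)
Lemma skew_1subr_unit q (t : R) (W : 'M[R[i]]_q) :
  W^t* = - W -> 1%:M - t%:C *: W \in unitmx.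
Proof.
move=> Ws; rewrite -row_free_unit -kermx_eq0; set K := kermx _.
have KE : K = t%:C *: (K *m W).
  apply/eqP; rewrite -subr_eq0 scalemxAr -{1}[K]mulmx1 -mulmxBr.
  by rewrite mulmx_ker.
apply/eqP/inner_eq0; rewrite {2}KE innerZr inner_mulr inner_herm_skew ?mulr0 //.
by rewrite trmxCM trmxCK.
Qed.

(** The Cayley transform $(1-tW)^{-1}(1+tW)$: its two factors commute, and $1+tW$ and $1-tW$ are
    adjoint to each other. *)
Lemma cayley_unitary q (t : R) (W : 'M[R[i]]_q) : W^t* = - W ->
  exists2 O, O \is unitarymx & 1%:M + t%:C *: W = (1%:M - t%:C *: W) *m O.
Proof.
move=> Ws; pose P := 1%:M + t%:C *: W; pose M := 1%:M - t%:C *: W.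
have Mu : M \in unitmx by exact: skew_1subr_unit.
have PM : P^t* = M.
  by rewrite trmxCD trmxC_realZ Ws trmx1 map_mx1 scalerN.
have MP : M^t* = P by rewrite -PM trmxCK.
exists (invmx M *m P); last by rewrite mulKVmx.
apply/unitarymxP; rewrite trmxCM PM.
have PMC : P *m M = M *m P.
  rewrite /P /M !mulmxDl !mulmxDr !mulmxN !mulNmx !mul1mx !mulmx1.
  by rewrite !addrA addrK subrK.
have iMP : (invmx M)^t* *m P = 1%:M.
  by rewrite -MP -trmxCM mulmxV // trmx1 map_mx1.
have Pu : P \in unitmx by case/mulmx1_unit: iMP.
have -> : (invmx M)^t* = invmx P by rewrite -[LHS](mulmxK Pu) iMP mul1mx.
by rewrite mulmxA -[_ *m P *m M]mulmxA PMC mulKmx // mulmxV.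
Qed.

End Inner.

(** * Closure properties of smooth functions *)

Section Smooth.
Context {R : realType}.
Implicit Types (V W : normedModType R) (k : nat).

Lemma near_eq_differentiable V W (f g : V -> W) x :
  {near x, f =1 g} -> differentiable f x -> differentiable g x.
Proof.
move=> fg df; rewrite -[g](subrK f); apply: (differentiableD _ df).
(* The difference vanishes near [x], so the zero map is its differential there. *)
set d := g - f; pose z : {linear V -> W} := \0.
have z_cont : continuous z by move=> y; exact: cvg_cst.
have d0 : d \o shift x = cst (d x) + z +o_ (0 : V) id.
  apply/eqaddoP => e e0.
  have : \forall y \near (0 : V), f (y + x) = g (y + x).
    by move/nbhs0P: fg; apply: filterS => y; rewrite addrC.
  apply: filterS => y fgy.
  rewrite /d !fctE /= fgy (nbhs_singleton fg) !subrr addr0 subr0 normr0.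
  by rewrite mulr_ge0 // ltW.
by apply/diff_locallyP; rewrite (diff_unique z_cont d0).
Qed.

Lemma smooth_upto_differentiable V k (U : set V) (f : V -> R) x :
  smooth_upto k U f -> U x -> differentiable f x.
Proof. by case: k => [|k] [df _]; exact: df. Qed.

Lemma smooth_uptoS V k (U : set V) (f : V -> R) :
  smooth_upto k.+1 U f -> smooth_upto k U f.
Proof.
elim: k f => [|k IH] f [df Df]; split => // v.
by apply: IH; exact: Df.
Qed.

Lemma smooth_upto_sub V k (U U' : set V) (f : V -> R) :
  U `<=` U' -> smooth_upto k U' f -> smooth_upto k U f.
Proof.
move=> UU'; elim: k f => [|k IH] f [df Df].
  by split=> // x /UU'; exact: df.
by split=> [x /UU'|v]; [exact: df | apply: IH; exact: Df].
Qed.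

(** Openness turns equality on [U] into equality near each point, which passes to directional
    derivatives and so through the induction. *)
Lemma smooth_upto_eq V k (U : set V) (f g : V -> R) : open U ->
  (forall x, U x -> f x = g x) -> smooth_upto k U f -> smooth_upto k U g.
Proof.
move=> Uo; elim: k f g => [|k IH] f g fg [df Df].
  split=> // x Ux; apply: near_eq_differentiable (df _ Ux).
  by apply: filterS fg _; exact: open_nbhs_nbhs.
have fgx x : U x -> {near x, f =1 g}.
  by move=> Ux; apply: filterS fg _; exact: open_nbhs_nbhs.
split=> [x Ux|v]; first exact: near_eq_differentiable (fgx _ Ux) (df _ Ux).
apply: IH (Df v) => x Ux; case: (eqVneq v 0) => [->|v0].
  by rewrite !derive0.
exact/near_eq_derive/fgx.
Qed.

Lemma smooth_upto_cst V k (a : R) : smooth_upto k setT (fun _ : V => a).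
Proof.
elim: k a => [|k IH] a; split => // v.
rewrite (_ : 'D_v _ = fun=> 0); first exact: IH.
by apply/funext => x; exact: (derive_cst _ x v).
Qed.

Lemma smooth_upto_linear V k (f : {linear V -> R}) :
  continuous f -> smooth_upto k setT f.
Proof.
move=> fc; have df x : differentiable f x by exact: linear_differentiable.
case: k => [|k]; split => // v.
rewrite (_ : 'D_v _ = fun=> f v); first exact: smooth_upto_cst.
by apply/funext => x; rewrite deriveE // diff_lin.
Qed.

Lemma smooth_uptoD V k (f g : V -> R) : smooth_upto k setT f ->
  smooth_upto k setT g -> smooth_upto k setT (fun x => f x + g x).
Proof.
elim: k f g => [|k IH] f g [df Df] [dg Dg].
  by split => // x _; apply: (differentiableD (df x I) (dg x I)).
split=> [x _|v]; first by apply: (differentiableD (df x I) (dg x I)).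
rewrite (_ : 'D_v _ = fun x => 'D_v f x + 'D_v g x).
  by apply: IH; [exact: Df | exact: Dg].
by apply/funext => x; apply: deriveD; apply: diff_derivable;
  [exact: df | exact: dg].
Qed.

Lemma smooth_uptoM V k (f g : V -> R) : smooth_upto k setT f ->
  smooth_upto k setT g -> smooth_upto k setT (fun x => f x * g x).
Proof.
elim: k f g => [|k IH] f g sf sg.
  by split => // x _; apply: (differentiableM (sf.1 x I) (sg.1 x I)).
split=> [x _|v]; first by apply: (differentiableM (sf.1 x I) (sg.1 x I)).
rewrite (_ : 'D_v _ = fun x => f x * 'D_v g x + g x * 'D_v f x).
  by apply: smooth_uptoD; apply: IH; [exact: smooth_uptoS | exact: sg.2
    | exact: smooth_uptoS | exact: sf.2].
apply/funext => x.
by apply: deriveM; apply: diff_derivable; [exact: sf.1 | exact: sg.1].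
Qed.

Lemma smooth_upto_sum V k (I : finType) (f : I -> V -> R) :
  (forall i, smooth_upto k setT (f i)) ->
  smooth_upto k setT (fun x => \sum_i f i x).
Proof.
move=> sf; rewrite (_ : (fun x => \sum_i f i x) = \sum_i f i).
  apply: (big_ind (smooth_upto k setT)) => //; first exact: smooth_upto_cst.
  by move=> *; exact: smooth_uptoD.
by apply/funext => x; rewrite fct_sumE.
Qed.

Lemma is_diff_sum V W (I : finType) (f df : I -> V -> W) x :
  (forall i, is_diff x (f i) (df i)) ->
  is_diff x (\sum_i f i) (\sum_i df i).
Proof.
move=> fdf; apply: (big_ind2 (fun g dg => is_diff x g dg)) => //.
  exact: is_diff_cst.
by move=> *; exact: is_diffD.
Qed.

(** The inner map is given by scalar coefficients along fixed vectors, so the chain rule yields a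
    finite sum of products $D_vq_i\cdot(D_{e_i}f)\circ Q$. The second factors are again compositions
    of this form, at one order less. *)
Lemma smooth_upto_comp V W k (I : finType) (e : I -> W) (q : I -> V -> R)
    (f : W -> R) :
  (forall i, smooth_upto k setT (q i)) -> smooth_upto k setT f ->
  smooth_upto k setT (fun x => f (\sum_i q i x *: e i)).
Proof.
set Q := fun x => \sum_i q i x *: e i.
have dQ : (forall i x, differentiable (q i) x) ->
    forall x, is_diff x Q (\sum_i (fun v => 'd (q i) x v *: e i)).
  move=> dq x; rewrite (_ : Q = \sum_i (fun x => q i x *: e i)).
    apply: (is_diff_sum (f := fun i y => q i y *: e i)) => i.
    apply: DiffDef; first exact: differentiableZl.
    exact: (diffZl _ (dq i x)).
  by apply/funext => y; rewrite fct_sumE.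
have dfQ g x : (forall i x, differentiable (q i) x) ->
    differentiable g (Q x) -> differentiable (g \o Q) x.
  by move=> dq dg; apply: differentiable_comp => //; case: (dQ dq x).
elim: k f => [|k IH] f sq sf.
  split=> // x _; apply: dfQ; last exact: sf.1.
  by move=> i y; exact: (sq i).1.
have dq i x : differentiable (q i) x by exact: (sq i).1.
split=> [x _|v]; first by apply: dfQ => //; exact: sf.1.
rewrite (_ : 'D_v _ =
    fun x => \sum_i 'D_v (q i) x * 'D_(e i) f (\sum_i q i x *: e i)).
  apply: smooth_upto_sum => i; apply: smooth_uptoM; first exact: (sq i).2.
  apply: (IH ('D_(e i) f)) => [j|]; last exact: sf.2.
  exact: smooth_uptoS.
apply/funext => x; rewrite -/(Q x).
have df : differentiable f (Q x) by exact: sf.1.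
have dQx := dQ dq x.
rewrite deriveE; last exact: dfQ.
rewrite (diff_comp _ df) /=; last by case: dQx.
rewrite diff_val fct_sumE raddf_sum; apply: eq_bigr => i _.
by rewrite [LHS]linearZ /= !deriveE.
Qed.

End Smooth.

(** * Calculus on complex matrices *)

Section RealCoordinates.
Context {R : realType}.
Implicit Types (m q : nat).

Lemma to_realK m q (A : 'M[R[i]]_(m, q)) : of_real (to_real A) = A.
Proof. by apply/matrixP => i j; rewrite !mxE; case: (A i j). Qed.

Lemma to_realN m q (A : 'M[R[i]]_(m, q)) : to_real (- A) = - to_real A.
Proof.
by congr (_, _); apply/matrixP => i j; rewrite !mxE; case: (A i j).
Qed.

Lemma of_real_line m q (A Y : 'M[R[i]]_(m, q)) (t : R) :
  of_real (t *: to_real A + to_real Y) = t%:C *: A + Y.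
Proof.
apply/matrixP => i j; rewrite !mxE.
by case: (A i j) (Y i j) => a b [c d] /=; simpc.
Qed.

(** A single finite index type for real and imaginary entries puts matrix maps into the coefficient
    form of [smooth_upto_comp]. *)
Definition real_coord m q (s : 'I_m * 'I_q + 'I_m * 'I_q)
    (Z : 'M[R]_(m, q) * 'M[R]_(m, q)) : R :=
  match s with inl ij => Z.1 ij.1 ij.2 | inr ij => Z.2 ij.1 ij.2 end.

Definition real_basis m q (s : 'I_m * 'I_q + 'I_m * 'I_q) :
    'M[R]_(m, q) * 'M[R]_(m, q) :=
  match s with
  | inl ij => (delta_mx ij.1 ij.2, 0) | inr ij => (0, delta_mx ij.1 ij.2)
  end.

Lemma real_coord_sum m q (Z : 'M[R]_(m, q) * 'M[R]_(m, q)) :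
  Z = \sum_s real_coord s Z *: real_basis s.
Proof.
rewrite big_sumType /=.
have inlE (A : 'M[R]_(m, q)) : (A, 0) = \sum_(ij : 'I_m * 'I_q)
    A ij.1 ij.2 *: (delta_mx ij.1 ij.2, 0) :> 'M[R]_(m, q) * 'M[R]_(m, q).
  rewrite {1}(matrix_sum_delta A) pair_bigA.
  rewrite (big_morph (fun A => (A, 0 : 'M[R]_(m, q)))
    (id1 := 0) (op1 := +%R)) // => [|B C]; last by congr (_, _); rewrite addr0.
  by apply: eq_bigr => ij _; congr (_, _); rewrite scaler0.
have inrE (A : 'M[R]_(m, q)) : (0, A) = \sum_(ij : 'I_m * 'I_q)
    A ij.1 ij.2 *: (0, delta_mx ij.1 ij.2) :> 'M[R]_(m, q) * 'M[R]_(m, q).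
  rewrite {1}(matrix_sum_delta A) pair_bigA.
  rewrite (big_morph (fun A => (0 : 'M[R]_(m, q), A))
    (id1 := 0) (op1 := +%R)) // => [|B C]; last by congr (_, _); rewrite addr0.
  by apply: eq_bigr => ij _; congr (_, _); rewrite scaler0.
rewrite -inlE -inrE; case: Z => Z1 Z2 /=.
by congr (_, _); rewrite ?addr0 ?add0r.
Qed.

Lemma eq_lim_punctured (f g : R -> R) :
  f =1 g -> lim (f @ 0^') = lim (g @ 0^').
Proof. by move=> /funext ->. Qed.

Lemma diff_mxE m q (F : 'M[R[i]]_(m, q) -> R) Y A :
  diff_mx F Y A =
  lim ((fun h : R => h^-1 *: (F (h%:C *: A + Y) - F Y)) @ 0^').
Proof.
rewrite /diff_mx /derive; apply: eq_lim_punctured => h /=.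
by rewrite of_real_line to_realK.
Qed.

Lemma diff_mx_quadratic m q (F : 'M[R[i]]_(m, q) -> R) Y A (c1 c2 : R) :
  (forall t : R, F (t%:C *: A + Y) = F Y + t * c1 + t ^+ 2 * c2) ->
  diff_mx F Y A = c1.
Proof.
move=> FE; rewrite diff_mxE; apply: cvg_lim => //.
apply: (@cvg_trans _ ((fun h : R => c1 + h * c2) @ 0^')).
  apply: near_eq_cvg; near=> h.
  have h0 : h != 0 by near: h; exact: nbhs_dnbhs_neq.
  rewrite FE -[F Y + _ + _]addrA [F Y + _]addrC addrK.
  rewrite /GRing.scale /= mulrDr mulKf //.
  by rewrite expr2 -mulrA mulKf.
apply: cvg_within_filter.
have -> : c1 = c1 + 0 * c2 by rewrite mul0r addr0.
rewrite {1}mul0r addr0; apply: cvgD; first exact: cvg_cst.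
by apply: cvgMr_tmp; exact: cvg_id.
Unshelve. all: by end_near. Qed.

(** Evenness equates the derivatives along [A] and [- A], while linearity of the differential makes
    them opposite. *)
Lemma diff_mx_even m q (F : 'M[R[i]]_(m, q) -> R) Y A :
  differentiable_mx F Y ->
  (forall t : R, F (t%:C *: A + Y) = F (t%:C *: (- A) + Y)) ->
  diff_mx F Y A = 0.
Proof.
move=> dF FE; have : diff_mx F Y (- A) = diff_mx F Y A.
  by rewrite !diff_mxE; apply: eq_lim_punctured => h; rewrite FE.
rewrite /diff_mx to_realN !deriveE // linearN => /eqP.
by rewrite eqNr => /eqP.
Qed.

Lemma diff_mx_invariant m q (F : 'M[R[i]]_(m, q) -> R) (O : 'M[R[i]]_q) Y A :
  (forall Z, F (Z *m O) = F Z) ->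
  diff_mx F (Y *m O) (A *m O) = diff_mx F Y A.
Proof.
move=> FO; rewrite !diff_mxE; apply: eq_lim_punctured => h.
by rewrite scalemxAl -mulmxDl !FO.
Qed.

Lemma diff_mx_riesz m q (F : 'M[R[i]]_(m, q) -> R) Y :
  differentiable_mx F Y -> exists G, is_nabla F Y G.
Proof.
move=> dF; set L := 'd (F \o @of_real R m q) (to_real Y).
pose c s := L (real_basis s).
(* The real and imaginary parts of each entry are the values of the differential on the matching
   basis vectors. *)
exists (\matrix_(i, j) (c (inl (i, j)) +i* c (inr (i, j)))).
split=> // A; rewrite /diff_mx deriveE // -/L innerE pair_bigA /=.
rewrite big_split [X in L X]real_coord_sum raddf_sum big_sumType /=.
congr (_ + _); apply: eq_bigr => -[i j] _ /=;
  by rewrite [LHS]linearZ !mxE /= mulrC.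
Qed.

Lemma nablaP m q (F : 'M[R[i]]_(m, q) -> R) Y :
  differentiable_mx F Y -> forall A, diff_mx F Y A = inner (nabla F Y) A.
Proof.
by move=> /diff_mx_riesz[G FG]; have [] : is_nabla F Y (nabla F Y)
  by exact: (xgetPex _ (ex_intro _ _ FG)).
Qed.

End RealCoordinates.

(** * Smooth complex-valued maps and openness of the full rank condition *)

Section ComplexSmooth.
Context {R : realType}.
Implicit Types (V : normedModType R).

Definition csmooth V (g : V -> R[i]) : Prop :=
  smooth_on setT (fun x => complex.Re (g x)) /\
  smooth_on setT (fun x => complex.Im (g x)).

Lemma csmooth_cst V (c : R[i]) : csmooth (fun _ : V => c).
Proof. by split=> k; exact: smooth_upto_cst. Qed.

Lemma csmoothD V (f g : V -> R[i]) :
  csmooth f -> csmooth g -> csmooth (fun x => f x + g x).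
Proof.
move=> [fr fi] [gr gi]; split=> k.
  rewrite (_ : (fun x => complex.Re (f x + g x)) =
     fun x => complex.Re (f x) + complex.Re (g x)); first exact: smooth_uptoD.
  by apply/funext => x; case: (f x) (g x) => a b [].
rewrite (_ : (fun x => complex.Im (f x + g x)) =
  fun x => complex.Im (f x) + complex.Im (g x)); first exact: smooth_uptoD.
by apply/funext => x; case: (f x) (g x) => a b [].
Qed.

Lemma csmoothM V (f g : V -> R[i]) :
  csmooth f -> csmooth g -> csmooth (fun x => f x * g x).
Proof.
move=> [fr fi] [gr gi]; split=> k.
  rewrite (_ : (fun x => complex.Re (f x * g x)) =
     fun x => complex.Re (f x) * complex.Re (g x) +
              (-1) * (complex.Im (f x) * complex.Im (g x))).
    apply: smooth_uptoD; first exact: smooth_uptoM.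
    by apply: smooth_uptoM; [exact: smooth_upto_cst|exact: smooth_uptoM].
  by apply/funext => x; rewrite mulN1r; case: (f x) (g x) => a b [].
rewrite (_ : (fun x => complex.Im (f x * g x)) =
  fun x => complex.Re (f x) * complex.Im (g x) +
           complex.Im (f x) * complex.Re (g x)).
  by apply: smooth_uptoD; exact: smooth_uptoM.
by apply/funext => x; case: (f x) (g x) => a b [].
Qed.

Lemma csmooth_conj V (f : V -> R[i]) :
  csmooth f -> csmooth (fun x => (f x)^*%R).
Proof.
move=> [fr fi]; split=> k.
  rewrite (_ : (fun x => complex.Re (f x)^*%R) = fun x => complex.Re (f x)).
    exact: fr.
  by apply/funext => x; case: (f x).
rewrite (_ : (fun x => complex.Im (f x)^*%R) =
  fun x => (-1) * complex.Im (f x)).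
  by apply: smooth_uptoM; [exact: smooth_upto_cst|exact: fi].
by apply/funext => x; rewrite mulN1r; case: (f x).
Qed.

Lemma csmooth_sum V (I : finType) (f : I -> V -> R[i]) :
  (forall i, csmooth (f i)) -> csmooth (fun x => \sum_i f i x).
Proof.
move=> sf; rewrite (_ : (fun x => \sum_i f i x) = \sum_i f i).
  apply: (big_ind (@csmooth V)) => //; first exact: csmooth_cst.
  by move=> *; exact: csmoothD.
by apply/funext => x; rewrite fct_sumE.
Qed.

Lemma csmooth_prod V (I : finType) (f : I -> V -> R[i]) :
  (forall i, csmooth (f i)) -> csmooth (fun x => \prod_i f i x).
Proof.
move=> sf; rewrite (_ : (fun x => \prod_i f i x) = \prod_i f i).
  apply: (big_ind (@csmooth V)) => //; first exact: csmooth_cst.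
  by move=> *; exact: csmoothM.
by apply/funext => x; rewrite fct_prodE.
Qed.

Definition csmooth_mx V m q (A : V -> 'M[R[i]]_(m, q)) : Prop :=
  forall i j, csmooth (fun x => A x i j).

Lemma csmooth_mulmx V m q r (A : V -> 'M[R[i]]_(m, q)) (B : V -> 'M_(q, r)) :
  csmooth_mx A -> csmooth_mx B -> csmooth_mx (fun x => A x *m B x).
Proof.
move=> sA sB i j.
rewrite (_ : (fun x => _) = fun x => \sum_k A x i k * B x k j).
  by apply: csmooth_sum => k; exact: csmoothM.
by apply/funext => x; rewrite mxE.
Qed.

Lemma csmooth_trmxC V m q (A : V -> 'M[R[i]]_(m, q)) :
  csmooth_mx A -> csmooth_mx (fun x => (A x)^t* ).
Proof.
move=> sA i j.
rewrite (_ : (fun x => _) = fun x => (A x j i)^*%R); first exact: csmooth_conj.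
by apply/funext => x; rewrite !mxE.
Qed.

Lemma csmooth_cst_mx V m q (A : 'M[R[i]]_(m, q)) : csmooth_mx (fun _ : V => A).
Proof. by move=> i j; exact: csmooth_cst. Qed.

Lemma csmooth_det V q (A : V -> 'M[R[i]]_q) :
  csmooth_mx A -> csmooth (fun x => \det (A x)).
Proof.
move=> sA; apply: csmooth_sum => s; apply: csmoothM; first exact: csmooth_cst.
by apply: csmooth_prod => i; exact: sA.
Qed.

Lemma smooth_real_coord m q k s : smooth_upto k setT (@real_coord R m q s).
Proof.
have lin : linear (@real_coord R m q s).
  by move=> a u v; case: s => ij; rewrite /= !mxE.
pose L : {linear _ -> _} := HB.pack (@real_coord R m q s)
  (GRing.isLinear.Build _ _ _ _ _ lin).
suff cont : continuous (@real_coord R m q s).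
  exact: (@smooth_upto_linear _ _ _ L cont).
move=> Z; case: {lin L} s => ij /=.
  apply: (@continuous_comp _ _ _ fst (fun M : 'M[R]_(m, q) => M ij.1 ij.2)).
    exact: cvg_fst.
  exact: coord_continuous.
apply: (@continuous_comp _ _ _ snd (fun M : 'M[R]_(m, q) => M ij.1 ij.2)).
  exact: cvg_snd.
exact: coord_continuous.
Qed.

Lemma csmooth_of_real m q : csmooth_mx (@of_real R m q).
Proof.
move=> i j; split=> k.
  rewrite (_ : (fun x => _) = real_coord (inl (i, j))).
    exact: smooth_real_coord.
  by apply/funext => Z; rewrite mxE.
rewrite (_ : (fun x => _) = real_coord (inr (i, j))).
  exact: smooth_real_coord.
by apply/funext => Z; rewrite mxE.
Qed.

Lemma smooth_mx_comp m q r s (f : 'M[R[i]]_(r, s) -> R)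
    (Q : 'M[R[i]]_(m, q) -> 'M_(r, s)) :
  csmooth_mx (Q \o @of_real R m q) -> smooth_mx setT f ->
  smooth_mx setT (f \o Q).
Proof.
move=> sQ sf k; pose u t Z := real_coord t (to_real (Q (of_real Z))).
have su t : smooth_upto k setT (u t).
  case: t => -[i j].
    rewrite (_ : u _ = fun Z => complex.Re (Q (of_real Z) i j)).
      exact: (sQ i j).1.
    by apply/funext => Z; rewrite /u /= mxE.
  rewrite (_ : u _ = fun Z => complex.Im (Q (of_real Z) i j)).
    exact: (sQ i j).2.
  by apply/funext => Z; rewrite /u /= mxE.
rewrite (_ : (f \o Q) \o @of_real R m q = fun Z =>
  (f \o @of_real R r s) (\sum_t u t Z *: real_basis t)).
  by apply: smooth_upto_comp => //; exact: sf.
by apply/funext => Z; rewrite /u -real_coord_sum /= to_realK.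
Qed.

(** A left inverse $B$ of the given matrix makes $\det(BW)$ equal to 1 there, hence nonzero nearby;
    where it is nonzero, $W$ has rank $p$. *)
Lemma open_fullrank n p : open (@of_real R n p @^-1` [set Y | \rank Y = p]).
Proof.
rewrite openE => Z /= rZ; have /row_fullP[B BZ] : row_full (of_real Z).
  by rewrite /row_full rZ.
pose g W := \det (B *m of_real W).
have [gr gi] : csmooth g.
  apply/csmooth_det/csmooth_mulmx; first exact: csmooth_cst_mx.
  exact: csmooth_of_real.
(* The squared modulus replaces the complex determinant by a real continuous function. *)
pose d W := complex.Re (g W) * complex.Re (g W) +
  complex.Im (g W) * complex.Im (g W).
have dc : continuous d.
  move=> W; apply: differentiable_continuous.
  apply: (@smooth_upto_differentiable _ _ 0 setT) => //.
  by apply: smooth_uptoD; apply: smooth_uptoM.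
have dZ : d Z > 0.
  by rewrite /d /g BZ det1 /= mulr1 mulr0 addr0.
have : nbhs Z (d @^-1` [set x | 0 < x]).
  apply: open_nbhs_nbhs; split => //.
  by apply: open_comp => [W _|]; [exact: dc | exact: open_gt].
apply: filterS => W /= dW.
have gW : g W != 0.
  by apply: contraTneq dW => gW; rewrite /d gW /= mulr0 addr0 ltxx.
apply/eqP; rewrite eqn_leq rank_leq_col /=.
apply: leq_trans (mxrankM_maxr B _).
have /eqP -> // : row_free (B *m of_real W).
by rewrite row_free_unit unitmxE unitfE.
Qed.

End ComplexSmooth.

(** * Horizontal lifts and the Riemannian gradient *)

(** An injective endomorphism of a finite-dimensional space is surjective; [mxvec] turns the
    Sylvester operator into a square matrix. *)
Lemma sylvester_solvable {K : fieldType} q (S C : 'M[K]_q) :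
  (forall W, S *m W + W *m S = 0 -> W = 0) -> exists W, S *m W + W *m S = C.
Proof.
move=> inj; pose L := lin_mx (mulmx S \+ mulmxr S).
have LE W : mxvec W *m L = mxvec (S *m W + W *m S) by rewrite mul_vec_lin.
have Lu : L \in unitmx.
  rewrite -row_free_unit; apply/inj_row_free => v.
  rewrite -[v]vec_mxK LE => /(canRL mxvecK); rewrite linear0 => /inj ->.
  by rewrite linear0.
exists (vec_mx (mxvec C *m invmx L)); apply: (can_inj mxvecK).
by rewrite -LE vec_mxK mulmxKV.
Qed.

Section QuotientGeometry.
Context {R : realType} {n p : nat}.
Implicit Types (Y Z : fullrank R n p) (A B G : 'M[R[i]]_(n, p))
  (phi : uquot R n p -> R) (Q W : 'M[R[i]]_p).

Lemma fullrankP Y : \rank Y = p.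
Proof. exact/eqP/(valP Y). Qed.

Lemma fullrank_linv Y : exists B : 'M_(p, n), B *m Y = 1%:M.
Proof. by apply/row_fullP; rewrite /row_full fullrankP. Qed.

Lemma quot_projP Y Z : quot_proj Y = quot_proj Z <->
  exists2 Q, Q \is unitarymx & (Z : 'M_(n, p)) = Y *m Q.
Proof.
split=> [/eqmodP/asboolP //|YZ]; apply/eqmodP/asboolP; exact: YZ.
Qed.

Lemma rank_mul_unitary A Q : Q \is unitarymx -> \rank (A *m Q) = \rank A.
Proof. by move=> Qu; rewrite mxrankMfree // row_free_unit unitarymx_unit. Qed.

(** Rank is unitarily invariant, so both sides are undefined together, not merely equal when
    defined. *)
Lemma insub_unitary A Q : Q \is unitarymx ->
  omap quot_proj (insub (A *m Q)) =
  omap quot_proj (insub A : option (fullrank R n p)).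
Proof.
move=> Qu; case: (insubP (fullrank R n p) A) => [Y rA YA|rA].
  rewrite insubT ?rank_mul_unitary // => rAO; congr Some; apply/esym/quot_projP.
  by exists Q => //; rewrite [fr_mx Y]YA.
by rewrite insubN // rank_mul_unitary.
Qed.

Lemma pullbackE phi Y : pullback phi Y = phi (quot_proj Y).
Proof. by rewrite /pullback valK. Qed.

Lemma pullback_unitary phi Q A :
  Q \is unitarymx -> pullback phi (A *m Q) = pullback phi A.
Proof.
move=> /(insub_unitary A); rewrite /pullback.
by case: insub => [Y|]; case: insub => [Z|] //= [->].
Qed.

Lemma smooth_quot_differentiable phi Y :
  smooth_quot phi -> differentiable_mx (pullback phi) Y.
Proof.
move=> sphi; apply: smooth_upto_differentiable (sphi 0) _.
by rewrite /= to_realK fullrankP.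
Qed.

(** The pullback agrees with [G] only on full rank matrices; that set being open, smoothness and
    derivatives carry over. *)
Lemma smooth_quot_of phi (G : 'M[R[i]]_(n, p) -> R) :
  smooth_mx setT G -> (forall Y, phi (quot_proj Y) = G Y) ->
  smooth_quot phi /\
  forall Y A, diff_mx (pullback phi) Y A = diff_mx G Y A.
Proof.
move=> sG phiG; pose U := @of_real R n p @^-1` [set A | \rank A = p].
have eqU w : U w ->
    (G \o @of_real R n p) w = (pullback phi \o @of_real R n p) w.
  move=> /eqP rw; have -> : (pullback phi \o @of_real R n p) w =
    pullback phi (FullRank rw) by [].
  by rewrite pullbackE phiG.
have oU : open U by exact: open_fullrank.
split=> [k|Y A].
  by apply: (smooth_upto_eq oU eqU); apply: smooth_upto_sub (sG k).
apply: near_eq_derive; apply: (filterS (fun w Uw => esym (eqU w Uw))).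
by apply: open_nbhs_nbhs; split; rewrite /U //= to_realK fullrankP.
Qed.

(* By the Cayley transform [1 + tW = (1 - tW) Q] with [Q] unitary, so the    *)
(* function is even along the line through [Y] directed by [Y W].            *)
Lemma diff_vertical (G : 'M[R[i]]_(n, p) -> R) A W :
  differentiable_mx G A ->
  (forall B Q, Q \is unitarymx -> G (B *m Q) = G B) ->
  W^t* = - W -> diff_mx G A (A *m W) = 0.
Proof.
move=> dG GO Ws; apply: (diff_mx_even dG) => t.
have [Q Qu WO] := cayley_unitary t Ws.
have -> : t%:C *: (A *m W) + A = A *m (1%:M + t%:C *: W).
  by rewrite mulmxDr mulmx1 scalemxAr addrC.
rewrite WO mulmxA GO //.
by rewrite mulmxBr mulmx1 scalerN scalemxAr addrC.
Qed.

(** A matrix $X$ is horizontal when $Y^*X$ is Hermitian. For $X=A-YW$ with $W$ skew and $S=Y^*Y$,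
    this is the Sylvester equation $SW+WS=Y^*A-A^*Y$. *)
Lemma horizontal_projection Y A :
  exists2 W, W^t* = - W & horizontal Y (A - Y *m W).
Proof.
have [S SE] : exists S, S = (Y : 'M_(n, p))^t* *m Y by eexists.
have Sh : S^t* = S by rewrite SE trmxCM trmxCK.
(* Pairing the equation with $W$ gives $|YW|^2+|WY^*|^2=0$, and $Y$ has a left inverse. *)
have inj W : S *m W + W *m S = 0 -> W = 0.
  move=> SW0; have WSW : inner W (S *m W) = inner (Y *m W) (Y *m W).
    by rewrite SE [RHS]inner_mulr mulmxA [LHS]innerC.
  have WWS : inner W (W *m S) =
      inner (W *m (Y : 'M_(n, p))^t* ) (W *m (Y : 'M_(n, p))^t* ).
    by rewrite SE mulmxA [LHS]inner_mull.
  have : inner W (S *m W + W *m S) = 0.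
    by rewrite SW0 /inner mulmx0 linear0.
  rewrite innerDr WSW WWS => /eqP; rewrite paddr_eq0 ?inner_ge0 //.
  move=> /andP[/eqP/inner_eq0 YW0 _].
  by have [B BY] := fullrank_linv Y; rewrite -[W]mul1mx -BY -mulmxA YW0 mulmx0.
have [W SW] := sylvester_solvable ((Y : 'M_(n, p))^t* *m A - A^t* *m Y) inj.
(* The right-hand side is skew, so $W^*+W$ solves the homogeneous equation. *)
have Ws : W^t* = - W.
  apply/eqP; rewrite -addr_eq0; apply/eqP/inj.
  rewrite mulmxDr mulmxDl addrACA SW.
  have <- : (S *m W + W *m S)^t* = S *m W^t* + W^t* *m S.
    by rewrite trmxCD !trmxCM Sh addrC.
  by rewrite SW trmxCD trmxCN !trmxCM !trmxCK addrC subrKA subrr.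
exists W => // _ [V Vs ->].
have XE : (Y : 'M_(n, p))^t* *m A = A^t* *m Y + (S *m W + W *m S).
  by rewrite SW addrC subrK.
rewrite /g1 inner_mulr inner_herm_skew //.
rewrite trmxCM trmxCK trmxCD trmxCN trmxCM Ws mulNmx opprK mulmxDl -mulmxA -SE.
by rewrite mulmxBr [in RHS]mulmxA -SE XE [S *m W + _]addrC addrA addrK.
Qed.

Lemma dprojE Y A phi :
  smooth_quot phi -> dproj Y A phi = diff_mx (pullback phi) Y A.
Proof. by move=> sphi; rewrite /dproj asboolT. Qed.

Lemma eq_dproj Y Z A B :
  (forall phi, smooth_quot phi ->
     diff_mx (pullback phi) Y A = diff_mx (pullback phi) Z B) ->
  dproj Y A = dproj Z B.
Proof.
move=> AB; apply/funext => phi; rewrite /dproj.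
by case: asboolP => [sphi|_]; [exact: AB | ].
Qed.

Lemma dproj_vertical Y A W :
  W^t* = - W -> dproj Y (A - Y *m W) = dproj Y A.
Proof.
move=> Ws; apply: eq_dproj => phi sphi.
have dphi := smooth_quot_differentiable Y sphi.
have := @diff_vertical _ _ W dphi (fun B Q Qu => pullback_unitary _ _ Qu) Ws.
by rewrite !(nablaP dphi) innerDr innerNr => ->; rewrite subr0.
Qed.

Lemma dproj_unitary Y Z Q A : Q \is unitarymx ->
  (Z : 'M_(n, p)) = Y *m Q -> dproj Z (A *m Q) = dproj Y A.
Proof.
move=> Qu ZE; apply: eq_dproj => phi _.
by rewrite ZE; apply: diff_mx_invariant => B; rewrite pullback_unitary.
Qed.

(** The vector may be presented at another representative: a unitary carries it to [Y], and
    subtracting the vertical part leaves its action unchanged. *)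
Lemma tangent_lift Y xi : tangent (quot_proj Y) xi ->
  exists2 A, horizontal Y A & dproj Y A = xi.
Proof.
move=> [Z [A [/quot_projP[Q Qu YE] ->]]].
have [W Ws hA] := horizontal_projection Y (A *m Q).
exists (A *m Q - Y *m W) => //.
by rewrite dproj_vertical // (dproj_unitary _ Qu YE).
Qed.

(** Real linear functionals of $AA^*$; they are unitarily invariant, so they descend to test
    functions on the quotient. *)
Definition gram_form (M : 'M[R[i]]_n) A : R := inner M (A *m A^t* ).

Lemma smooth_gram_form M : smooth_mx setT (gram_form M).
Proof.
suff [sr _] : csmooth (fun w =>
  \tr (M^t* *m (@of_real R n p w *m (of_real w)^t* ))) by [].
apply: csmooth_sum => i.
apply: csmooth_mulmx; first exact: csmooth_cst_mx.
apply: csmooth_mulmx; first exact: csmooth_of_real.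
by apply: csmooth_trmxC; exact: csmooth_of_real.
Qed.

Lemma diff_gram_form M Y A :
  diff_mx (gram_form M) Y A = inner M (A *m (Y : 'M_(n, p))^t* + Y *m A^t* ).
Proof.
apply: (diff_mx_quadratic (c2 := inner M (A *m A^t* ))) => t.
rewrite /gram_form.
have -> : (t%:C *: A + Y) *m (t%:C *: A + Y)^t* = Y *m (Y : 'M_(n, p))^t*
    + t%:C *: (A *m (Y : 'M_(n, p))^t* + Y *m A^t* )
    + (t ^+ 2)%:C *: (A *m A^t* ).
  rewrite trmxCD trmxC_realZ mulmxDl !mulmxDr -!scalemxAl -!scalemxAr.
  rewrite scalerA -rmorphM -expr2 scalerDr -[LHS]addrA [LHS]addrC.
  by congr (_ + _); rewrite addrA [LHS]addrC.
by rewrite !innerDr !innerZr innerDr.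
Qed.

Lemma horizontal_lift_unique Y A B : horizontal Y A -> horizontal Y B ->
  dproj Y A = dproj Y B -> A = B.
Proof.
move=> hA hB AB; pose D := A - B.
(* Testing with the derivative of $YY^*$ along $D$ itself makes the difference of the two
   derivatives equal to $\langle M,M\rangle$. *)
pose M := D *m (Y : 'M_(n, p))^t* + Y *m D^t*.
pose phi (x : uquot R n p) := gram_form M (repr x : fullrank R n p).
have phiE Z : phi (quot_proj Z) = gram_form M Z.
  have /quot_projP[Q Qu ZE] : quot_proj (repr (quot_proj Z)) = quot_proj Z.
    by rewrite /quot_proj reprK.
  by rewrite /phi /gram_form ZE trmxCM mulmxA mulmxtVK.
have [sphi dphi] := smooth_quot_of (@smooth_gram_form M) phiE.
have := congr1 (fun xi => xi phi) AB; rewrite !(dprojE _ _ sphi) !dphi.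
rewrite !diff_gram_form => /eqP; rewrite -subr_eq0 -innerNr -innerDr.
have -> : A *m (Y : 'M_(n, p))^t* + Y *m A^t*
    - (B *m (Y : 'M_(n, p))^t* + Y *m B^t* ) = M.
  by rewrite /M /D trmxCD trmxCN mulmxBl mulmxBr opprD addrACA.
move=> /eqP/inner_eq0 M0.
have [L LY] := fullrank_linv Y.
have YL : (Y : 'M_(n, p))^t* *m L^t* = 1%:M by rewrite -trmxCM LY trmx1 map_mx1.
have DY : D *m (Y : 'M_(n, p))^t* = - (Y *m D^t* ).
  by apply/eqP; rewrite -addr_eq0 -/M M0.
have [W DE] : exists W, D = Y *m W.
  (* Obtained from $DY^*=-YD^*$ by multiplying on the right by $L^*$. *)
  exists (- (D^t* *m L^t* )).
  by rewrite mulmxN mulmxA -mulNmx -DY -mulmxA YL mulmx1.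
have WE : W = L *m (D *m (Y : 'M_(n, p))^t* ) *m L^t*.
  by rewrite DE -!mulmxA YL mulmx1 mulmxA LY mul1mx.
(* $W$ inherits skewness from $DY^*$ through $W=L(DY^*{})L^*$; so $D$ is both vertical and
   horizontal. *)
have WN : W = - W^t*.
  rewrite {1}WE DY mulmxN mulNmx DE trmxCM -!mulmxA YL.
  by rewrite mulmx1 mulmxA LY mul1mx.
have vD : vertical Y D by exists W; [rewrite {2}WN opprK | exact: DE].
apply/eqP; rewrite -subr_eq0 -/D; apply/eqP/inner_eq0.
have AD : inner A D = 0 := hA _ vD.
have BD : inner B D = 0 := hB _ vD.
by rewrite {1}/D innerBl AD BD subrr.
Qed.

Lemma hlift_dproj Y A : horizontal Y A -> hlift Y (dproj Y A) = A.
Proof.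
move=> hA; apply: xget_unique => // B [hB BA].
exact: horizontal_lift_unique BA.
Qed.

(** * The gradient on the quotient and the comparison of the iterations *)

Section GradientOfQuotientFunction.
Context (F : 'M[R[i]]_(n, p) -> R) (h : uquot R n p -> R).
Context (smoothF : smooth_mx setT F).
Context (F_unitary : forall A Q, Q \is unitarymx -> F (A *m Q) = F A).
Context (hF : forall Y, h (quot_proj Y) = F Y).

Lemma diff_nabla A B : diff_mx F A B = inner (nabla F A) B.
Proof.
by apply: nablaP; exact: smooth_upto_differentiable (smoothF 0) _.
Qed.

Lemma nabla_horizontal Y : horizontal Y (nabla F Y).
Proof.
move=> _ [W Ws ->]; rewrite /g1 -diff_nabla; apply: diff_vertical => //.
exact: smooth_upto_differentiable (smoothF 0) _.
Qed.

(** Right multiplication by [Q] is an isometry preserving [F], so it carries gradients to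
    gradients. *)
Lemma nabla_unitary A Q :
  Q \is unitarymx -> nabla F (A *m Q) = nabla F A *m Q.
Proof.
move=> Qu; apply: inner_nondeg => B; rewrite -diff_nabla.
have {1 2}-> : B = B *m Q^t* *m Q by rewrite mulmxKtV.
rewrite diff_mx_invariant => [|C]; last exact: F_unitary.
by rewrite diff_nabla inner_unitary.
Qed.

Lemma rgradE Y : rgrad h (quot_proj Y) = dproj Y (nabla F Y).
Proof.
have [sh dh] := smooth_quot_of smoothF hF.
set x := quot_proj Y; pose Z : fullrank R n p := repr x.
have Zx : quot_proj Z = x by rewrite /quot_proj /Z reprK.
have [Q Qu ZE] : exists2 Q, Q \is unitarymx & (Z : 'M_(n, p)) = Y *m Q.
  exact/quot_projP.
(* [qmetric] is evaluated at the chosen representative, so the claim is moved there first. *)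
have -> : dproj Y (nabla F Y) = dproj Z (nabla F Z).
  by rewrite ZE (nabla_unitary _ Qu) (dproj_unitary _ Qu ZE).
have metricE A B : horizontal Z A -> horizontal Z B ->
    qmetric x (dproj Z A) (dproj Z B) = inner A B.
  move=> hA hB; rewrite /qmetric.
  exact: (congr2 (g1 Z) (hlift_dproj hA) (hlift_dproj hB)).
have derivE B : dproj Z B h = inner (nabla F Z) B.
  by rewrite (dprojE _ _ sh) dh diff_nabla.
have tangentZ B : tangent x (dproj Z B) by exists Z, B.
apply: xget_unique => [|xi [_ txi xih]].
  split=> // zeta; rewrite -Zx => /tangent_lift[B hB <-].
  by rewrite Zx (metricE _ _ (@nabla_horizontal Z) hB) derivE.
(* Any other gradient has a lift [A]; testing it against $A-\nabla F(Z)$ shows that this difference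
   has norm zero. *)
move: txi xih; rewrite -{1}Zx => /tangent_lift[A hA <-] Ah.
congr dproj; apply/eqP; rewrite -subr_eq0; apply/eqP/inner_eq0.
have hD : horizontal Z (A - nabla F Z).
  move=> B vB; rewrite /g1 innerBl [inner A B]hA //.
  by rewrite [inner _ B]nabla_horizontal // subrr.
by rewrite innerBl -(metricE A) // Ah // derivE subrr.
Qed.

Lemma hlift_rgrad Y : hlift Y (rgrad h (quot_proj Y)) = nabla F Y.
Proof. by rewrite rgradE hlift_dproj //; exact: nabla_horizontal. Qed.

(** At the representative $YQ$ the whole step is the step at $Y$ times $Q$, so it has the same class
    and is defined in the same cases. *)
Lemma retraction_rgrad Y (t : R) :
  retraction (quot_proj Y) (- t) (rgrad h (quot_proj Y)) =
  omap quot_proj (insub ((Y : 'M_(n, p)) - t%:C *: nabla F Y)).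
Proof.
rewrite /retraction; set Z : fullrank R n p := repr (quot_proj Y).
have Zx : quot_proj Z = quot_proj Y by rewrite /quot_proj /Z reprK.
have [Q Qu ZE] : exists2 Q, Q \is unitarymx & (Z : 'M_(n, p)) = Y *m Q.
  exact/quot_projP.
rewrite -Zx hlift_rgrad ZE (nabla_unitary _ Qu) rmorphN scaleNr.
by rewrite scalemxAl -mulmxBl insub_unitary.
Qed.

Lemma rgd_quotE (tau : nat -> R) Y0 k :
  rgd_quot h tau (quot_proj Y0) k = omap quot_proj (rgd h tau Y0 k).
Proof.
elim: k => // k IH; rewrite /= IH; case: (rgd h tau Y0 k) => //= Y.
by rewrite retraction_rgrad hlift_rgrad.
Qed.

Lemma rgd_burer_monteiro (tau : nat -> R) Y0 k :
  omap fr_mx (rgd h tau Y0 k) =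
     if [forall j : 'I_k.+1, \rank (burer_monteiro F tau Y0 j) == p]
     then Some (burer_monteiro F tau Y0 k) else None.
Proof.
elim: k => [|k IH].
  case: ifP => // /negP[]; apply/forallP => j.
  by rewrite ord1 /= (valP Y0).
(* The iterates up to [k.+1] have full rank when those up to [k] do and the newest one does,
   matching the way [rgd] stops. *)
have -> : [forall j : 'I_k.+2, \rank (burer_monteiro F tau Y0 j) == p] =
    [forall j : 'I_k.+1, \rank (burer_monteiro F tau Y0 j) == p] &&
    (\rank (burer_monteiro F tau Y0 k.+1) == p).
  apply/forallP/andP => [H|[/forallP H Hk] j].
    split; last exact: (H ord_max).
    by apply/forallP => j; exact: (H (widen_ord (leqnSn _) j)).
  have := ltn_ord j; rewrite ltnS leq_eqVlt => /orP[/eqP -> //|jk].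
  exact: (H (Ordinal jk)).
move: IH; case: [forall j : 'I_k.+1, _]; rewrite [rgd _ _ _ k.+1]/=;
  case: (rgd h tau Y0 k) => //= Y [YE].
rewrite hlift_rgrad -YE; set A := _ - _.
case: (insubP (fullrank R n p) A) => [Z rA ZA|/negPf -> //].
by rewrite rA /= [fr_mx Z]ZA.
Qed.

End GradientOfQuotientFunction.




End QuotientGeometry.

Unset Implicit Arguments.
Set Strict Implicit.

Theorem corollary5p2 (R : realType) (n p : nat) (f : 'M[R[i]]_n -> R)
    (F : 'M[R[i]]_(n, p) -> R) (h : uquot R n p -> R)
    (tau : nat -> R) (Y0 : fullrank R n p) :
  (1 <= p <= n)%N ->
  smooth_mx setT f ->
  (forall Y : 'M[R[i]]_(n, p), F Y = f (Y *m Y^t* )) ->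
  (forall Y : fullrank R n p, h (quot_proj Y) = F Y) ->
  (forall k, rgd_quot h tau (quot_proj Y0) k = omap quot_proj (rgd h tau Y0 k)) /\
  (forall k, omap fr_mx (rgd h tau Y0 k) =
     if [forall j : 'I_k.+1, \rank (burer_monteiro F tau Y0 j) == p]
     then Some (burer_monteiro F tau Y0 k) else None).
Proof.
move=> _ smoothf FE hF.
have smoothF : smooth_mx setT F.
  rewrite (_ : F = f \o (fun Y => Y *m Y^t* )); last exact/funext.
  apply: smooth_mx_comp smoothf; apply: csmooth_mulmx.
    exact: csmooth_of_real.
  by apply: csmooth_trmxC; exact: csmooth_of_real.
have F_unitary A Q : Q \is unitarymx -> F (A *m Q) = F A.
  by move=> Qu; rewrite !FE trmxCM mulmxA mulmxtVK.
split=> k; first exact: rgd_quotE smoothF F_unitary hF tau Y0 k.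
exact: rgd_burer_monteiro smoothF F_unitary hF tau Y0 k.
Qed.
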